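(* The following hold: \begin{equation*} \frac{V(n,x)}{V (n-1,x)}<\frac{x+\sqrt{4n-2+x^2}}{2},\quad x>0,\ n\in (2k-1,2k),\ k\in {\mathbb N}; \end{equation*} \begin{equation*} \frac{x+\sqrt{4n-6+x^2}}{2}<\frac{V(n,x)}{V (n-1,x)},\quad x>0,\ n\in (2k,2k+1),\ k\in {\mathbb N}; \end{equation*} \begin{equation*} -i\frac{H_{2k+1}(ix)}{H_{2k}(ix)}<x+\sqrt{4k+2+x^2},\quad x>0,\ k =0,1,2,\ldots; \end{equation*} \begin{equation*} i\frac{H_{2k-1}(ix)}{H_{2k}(ix)}<(x+\sqrt{4k-2+x^2})^{-1},\quad x>0,\ k\in{\mathbb N}; \end{equation*} \begin{equation*} \frac{H_{2k}(ix)^2}{H_{2k-1}(ix)H_{2k+1}(ix)}>\sqrt{\frac{k-1/2}{k+1/2}},\quad k\in {\mathbb N},\ x\in {\mathbb R}. \end{equation*}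
   Context: $V(a,x)$ denotes the standard second parabolic cylinder function (as in the NIST Digital Library of Mathematical Functions, Chapter 12), a solution of $y''(x)-(x^2/4+a)y(x)=0$ that is dominant as $x\rightarrow+\infty$; $H_n$ denotes the Hermite polynomial of degree $n$ (with positive leading coefficient $2^n$), evaluated here at imaginary argument $ix$. The parameter $n$ is real and $i$ is the imaginary unit.
   Formalization: In the last inequality x is taken to be a nonzero real number: at x = 0 the odd-degree Hermite polynomials H_{2k-1} and H_{2k+1} vanish, so the quotient on the left is undefined there. *)

(* Defs.v *)
From HB Require Import structures.
From mathcomp Require Import all_boot all_order all_algebra.
From mathcomp Require Import all_classical all_reals all_analysis.
From mathcomp Require Import complex.
Set Implicit Arguments. Unset Strict Implicit. Unset Printing Implicit Defensive.
Import Order.TTheory GRing.Theory Num.Theory.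
Local Open Scope classical_set_scope.
Local Open Scope ring_scope.

(* Hermite polynomials (physicists'), H_0 = 1, H_1 = 2X,
   H_{n+2} = 2X H_{n+1} - 2(n+1) H_n ; leading coefficient 2^n. *)
Fixpoint hermite_pair (R : nzRingType) (n : nat) : {poly R} * {poly R} :=
  match n with
  | 0 => (1, 2%:R *: 'X)
  | m.+1 => let: (p, q) := hermite_pair R m in
            (q, 2%:R *: 'X * q - (2 * m.+1)%:R *: p)
  end.
Definition hermite (R : nzRingType) (n : nat) : {poly R} := (hermite_pair R n).1.

Definition pcf_int (R : realType) (a s : R) : R :=
  Rintegral (@lebesgue_measure R) `[0%R, +oo[%classic
    (fun t => powR t (a - 2^-1) * expR (- (t ^+ 2) / 2 - s * t)).

(* Second parabolic cylinder function V(a,x) (DLMF 12.2.15 combined with the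
   integral representation DLMF 12.5.1 of U(a,.), valid for a > -1/2; the
   Gamma(1/2+a) factors cancel):
   V(a,x) = (1/pi) Gamma(1/2+a) (sin(pi a) U(a,x) + U(a,-x))
          = exp(-x^2/4)/pi * (sin(pi a) I(a,x) + I(a,-x)). *)
Definition pcfV (R : realType) (a x : R) : R :=
  expR (- (x ^+ 2) / 4) / pi * (sin (pi * a) * pcf_int a x + pcf_int a (- x)).

(* Main.v *)
(* Write W(a, x) for V(a, x) without its factor exp(-x^2/4)/pi. Integration by
   parts gives W(a+2) = (a+1/2) W(a) + x W(a+1). When sin(pi a) >= 0, the
   numbers W(a), W(a+1), W(a+2) are the moments of order 0, 1, 2 of a positive
   measure on the real line, so W(a+1)^2 < W(a) W(a+2) by Cauchy-Schwarz;
   inserting the recurrence makes this a quadratic inequality for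
   r = W(a+1)/W(a), hence the upper bound. Then W(a+2)/W(a+1) = x + (a+1/2)/r
   turns the upper bound for r into the lower bound for the next ratio.

   With h_n(x) = i^-n H_n(ix), the Hermite bounds follow in the same way from
   D_n = h_n h_(n+2) - h_(n+1)^2 > 0 for even n. Here
   D_n = 2 (h_n^2 - 2n h_(n-1)^2) + 4n(n-1) D_(n-2), and for even n the
   polynomial h_n^2 - 2n h_(n-1)^2 is nonnegative at 0 and has derivative
   8 n x h_(n-1)^2. *)
Require Import Defs.
From HB Require Import structures.
From mathcomp Require Import all_boot all_order all_algebra.
From mathcomp Require Import all_classical all_reals all_analysis.
From mathcomp Require Import complex.
From mathcomp Require Import measurable_realfun ring lra.
Import Order.TTheory GRing.Theory Num.Theory.
Import numFieldNormedType.Exports.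
Local Open Scope ring_scope.

(** * Integration over the open half-line by compact exhaustion *)

Section half_line.
Local Open Scope classical_set_scope.
Context {R : realType}.
Notation mu := (@lebesgue_measure R).
Local Notation Rpos := (`]0%R, +oo[%classic : set R).
Implicit Types (f F : R -> R) (t : R).

(** The shift by 2 makes the endpoints distinct already at [n = 0], and every interval stays away
    from 0, where integrands may be singular. *)
Definition exhausting_itv (n : nat) : set R := `[n.+2%:R^-1, n.+2%:R].

Lemma nondecreasing_exhausting_itv : nondecreasing_seq exhausting_itv.
Proof.
apply/nondecreasing_seqP => n; rewrite subsetEset => t.
rewrite /exhausting_itv /= !in_itv/= => /andP[h1 h2]; apply/andP; split.
  by rewrite (le_trans _ h1)// lef_pV2 ?posrE// ler_nat.
by rewrite (le_trans h2)// ler_nat.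
Qed.

Lemma exhausting_itv_gt0 n t : exhausting_itv n t -> 0 < t.
Proof. by rewrite /exhausting_itv /= in_itv/= => /andP[+ _]; apply: lt_le_trans. Qed.

Lemma exhausting_itv_near t : 0 < t -> \forall n \near \oo, exhausting_itv n t.
Proof.
move=> t0; near=> n; rewrite /exhausting_itv /= in_itv/=; apply/andP; split.
  rewrite -[leRHS]invrK lef_pV2 ?posrE ?invr_gt0//.
  apply: (@le_trans _ _ n%:R); last by rewrite ler_nat -addn2 leq_addr.
  by near: n; exact: nbhs_infty_ger.
apply: (@le_trans _ _ n%:R); last by rewrite ler_nat -addn2 leq_addr.
by near: n; exact: nbhs_infty_ger.
Unshelve. all: by end_near. Qed.

Lemma bigcup_exhausting_itv : \bigcup_n exhausting_itv n = Rpos.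
Proof.
apply/seteqP; split=> t /=.
  by move=> [n _ /exhausting_itv_gt0]; rewrite in_itv/= andbT.
rewrite in_itv/= andbT => /exhausting_itv_near[n _ /(_ n (leqnn n))] tn.
by exists n.
Qed.

Lemma integral_exhausting_itv f F n :
  (forall t : R, 0 < t -> {for t, continuous f}) ->
  (forall t : R, 0 < t -> is_derive t 1 F (f t)) ->
  (\int[mu]_(t in exhausting_itv n) (f t)%:E =
   (F n.+2%:R)%:E - (F n.+2%:R^-1)%:E)%E.
Proof.
move=> cf dF.
have n0 : (0 : R) < n.+2%:R^-1 by rewrite invr_gt0.
have nn : n.+2%:R^-1 < n.+2%:R :> R.
  by rewrite (@lt_trans _ _ 1)// ?invf_lt1 ?ltr1n.
have cF : {within `[n.+2%:R^-1, n.+2%:R], continuous F}.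
  apply: derivable_within_continuous => t; rewrite in_itv/= => /andP[h _].
  have t0 := lt_le_trans n0 h.
  exact: (@ex_derive _ _ _ _ _ _ _ (dF t t0)).
apply: continuous_FTC2 => //.
- apply: continuous_in_subspaceT => t; rewrite inE/= in_itv/= => /andP[h _].
  exact/cf/(lt_le_trans n0 h).
- have [_ h1 h2] := (continuous_within_itvP F nn).1 cF.
  split=> // t; rewrite in_itv/= => /andP[h _].
  have t0 := lt_trans n0 h.
  exact: (@ex_derive _ _ _ _ _ _ _ (dF t t0)).
- move=> t; rewrite in_itv/= => /andP[h _].
  have t0 := lt_trans n0 h.
  by rewrite derive1E (@derive_val _ _ _ _ _ _ _ (dF t t0)).
Qed.

Lemma measurable_fun_half_line f :
  (forall t : R, 0 < t -> {for t, continuous f}) -> measurable_fun Rpos f.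
Proof.
move=> cf; apply: open_continuous_measurable_fun => // t.
by rewrite inE/= in_itv/= andbT => /cf.
Qed.

(** By monotone convergence the integral is the limit of the increments of [F] over the exhausting
    intervals, each at most [M + M]. *)
Lemma integrable_bounded_primitive f F (M : R) :
  (forall t : R, 0 < t -> {for t, continuous f}) ->
  (forall t : R, 0 < t -> is_derive t 1 F (f t)) ->
  (forall t : R, 0 < t -> 0 <= f t) ->
  (forall t : R, 0 < t -> `|F t| <= M) ->
  mu.-integrable Rpos (EFin \o f).
Proof.
move=> cf dF f0 FM.
have mf := measurable_fun_half_line _ cf.
apply/integrableP; split; first exact/measurable_EFinP.
apply: (@le_lt_trans _ _ (M + M)%:E); last by rewrite ltry.
have -> : (\int[mu]_(t in Rpos) `|(EFin \o f) t| =
    \int[mu]_(t in Rpos) (EFin \o f) t)%E.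
  by apply: eq_integral => t; rewrite inE/= in_itv/= andbT => t0; rewrite /= ger0_norm// f0.
rewrite -bigcup_exhausting_itv.
have mE n : measurable (exhausting_itv n) by exact: measurable_itv.
have mfE n : measurable_fun (exhausting_itv n) (EFin \o f).
  apply/measurable_EFinP; apply: measurable_funS mf => //.
  by move=> t /exhausting_itv_gt0 /=; rewrite in_itv/= andbT.
have fE n t : exhausting_itv n t -> (0 <= (EFin \o f) t)%E.
  by move=> /exhausting_itv_gt0 /f0; rewrite lee_fin.
have h : (\int[mu]_(t in exhausting_itv n) (EFin \o f) t @[n --> \oo] -->
    \int[mu]_(t in \bigcup_n exhausting_itv n) (EFin \o f) t)%E.
  apply: ge0_nondecreasing_set_cvg_integral => //.
  exact: nondecreasing_exhausting_itv.
rewrite -(cvg_lim _ h)//; apply: lime_le.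
  by apply/cvg_ex; eexists; exact: h.
apply: nearW => n; rewrite (integral_exhausting_itv _ _ _ cf dF) lee_fin.
have := FM n.+2%:R; have := FM n.+2%:R^-1.
rewrite invr_gt0 ltr0n => /(_ isT) h1 /(_ isT) h2.
move: h1 h2; rewrite !ler_norml => /andP[h1 h1'] /andP[h2 h2']; lra.
Qed.

(** Integration by parts without boundary term. The truncations of [f] are dominated by its absolute
    value, and their integrals are increments of [F], which tend to 0. *)
Lemma Rintegral_derivative_eq0 f F :
  (forall t : R, 0 < t -> {for t, continuous f}) ->
  (forall t : R, 0 < t -> is_derive t 1 F (f t)) ->
  mu.-integrable Rpos (EFin \o f) ->
  F n.+2%:R @[n --> \oo] --> (0 : R) ->
  F n.+2%:R^-1 @[n --> \oo] --> (0 : R) ->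
  Rintegral mu Rpos f = 0.
Proof.
move=> cf dF intf Fy F0.
pose g n t := ((f \_ (exhausting_itv n)) t)%:E.
have mf : measurable_fun Rpos f by exact: measurable_fun_half_line.
have sub n : exhausting_itv n `<=` Rpos.
  by move=> t /exhausting_itv_gt0 /=; rewrite in_itv/= andbT.
have mE n : measurable (exhausting_itv n) by exact: measurable_itv.
have gint n : (\int[mu]_(t in Rpos) g n t =
    (F n.+2%:R - F n.+2%:R^-1)%:E)%E.
  rewrite EFinB -(integral_exhausting_itv _ _ _ cf dF) [RHS]integral_mkcond.
  rewrite [LHS]integral_mkcond.
  apply: eq_integral => t _; rewrite /g !patchE.
  have [tn|tn] := boolP (t \in exhausting_itv n).
    by rewrite ifT// inE; exact: sub (set_mem tn).
  by case: ifP.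
have [| | | | |_ _ h] := @dominated_convergence _ _ R mu Rpos
    (measurable_itv _) g (EFin \o f) (EFin \o (fun t => `|f t|)).
- move=> n; apply/measurable_EFinP.
  apply/(measurable_restrict f (mE n) (measurable_itv _)).
  by apply: measurable_funS mf => //; apply: subIsetl.
- exact/measurable_EFinP.
- apply: aeW => t; rewrite /= in_itv/= andbT => t0.
  apply: cvg_near_cst; near=> n; rewrite /g patchE ifT// inE.
  by near: n; exact: exhausting_itv_near.
- exact: integrable_norm.
- apply: aeW => t n _; rewrite /g patchE lee_fin.
  by case: ifP => //; rewrite normr0.
rewrite /Rintegral.
suff -> : (\int[mu]_(t in Rpos) (f t)%:E = 0)%E by [].
apply: (cvg_unique _ h) => //=.
under eq_cvg do rewrite gint.
apply: cvg_EFin; first exact: nearW.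
by rewrite -(subrr (0 : R)); apply: cvgB.
Unshelve. all: by end_near. Qed.


End half_line.

(** If the integral were 0, then [f] would vanish almost everywhere on [D], so [D] would lie in a
    null set. *)
Lemma Rintegral_gt0 {d : measure_display} {T : measurableType d} {R : realType}
    (mu : {measure set T -> \bar R}) (D : set T) (f : T -> R) :
  measurable D -> (0 < mu D)%E -> mu.-integrable D (EFin \o f) ->
  (forall t, D t -> 0 < f t) -> 0 < Rintegral mu D f.
Proof.
move=> mD muD intf f0.
have mf : measurable_fun D (EFin \o f) by exact: measurable_int intf.
have fin := integrable_fin_num mD intf.
rewrite lt_neqAle Rintegral_ge0 ?andbT; last by move=> t /f0/ltW.
apply/eqP => /esym I0.
have /(ae_eq_integral_abs mu mD mf) [N [mN N0 DN]] :
    (\int[mu]_(t in D) `|(EFin \o f) t| = 0)%E.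
  rewrite -[RHS](_ : (Rintegral mu D f)%:E = 0%E); last by rewrite I0.
  rewrite /Rintegral fineK//; apply: eq_integral => t /[!inE] Dt.
  by rewrite /= ger0_norm// ltW// f0.
have : (mu D <= mu N)%E.
  apply: le_measure; rewrite ?inE// => t Dt; apply: DN => /= /(_ Dt) [] ft.
  by have := f0 _ Dt; rewrite ft ltxx.
by rewrite N0 leNgt muD.
Qed.

(** * The integrand of the parabolic cylinder integral *)

Section weight.
Local Open Scope classical_set_scope.
Context {R : realType}.
Notation mu := (@lebesgue_measure R).
Local Notation Rpos := (`]0%R, +oo[%classic : set R).
Implicit Types (p s t a x : R).

(** With [p = a - 2^-1] this is the integrand of [pcf_int a s]. Keeping [p] free makes
    multiplication by [t] a shift of the exponent. *)
Definition weight p s t : R := t `^ p * expR (- (t ^+ 2) / 2 - s * t).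

Lemma weight_gt0 p s t : 0 < t -> 0 < weight p s t.
Proof. by move=> t0; rewrite mulr_gt0 ?powR_gt0 ?expR_gt0. Qed.

Lemma weightD1 p s t : 0 < t -> weight (p + 1) s t = t * weight p s t.
Proof.
move=> t0; rewrite /weight powRD ?(gt_eqF t0) ?implybT// powRr1 ?ltW//.
by rewrite [_ * t]mulrC mulrA.
Qed.

Lemma is_derive_weight p s t : 0 < t -> is_derive t 1 (weight p s)
  (p * weight (p - 1) s t - weight (p + 1) s t - s * weight p s t).
Proof.
move=> t0.
have dpow := is_derive1_powR p t0.
have dexp : is_derive t 1 (fun u : R => expR (- (u ^+ 2) / 2 - s * u))
    (expR (- (t ^+ 2) / 2 - s * t) * (- t - s)).
  have dq : is_derive t 1 (fun u : R => - (u ^+ 2) / 2 - s * u) (- t - s).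
    apply: is_derive_eq.
    by rewrite /GRing.scale /=; field.
  exact: (is_derive1_comp (is_derive_expR _) dq).
apply: is_derive_eq.
rewrite weightD1// /weight /GRing.scale/=; ring.
Qed.

Lemma continuous_weight p s t : 0 < t -> {for t, continuous (weight p s)}.
Proof.
move=> t0; apply: differentiable_continuous; apply/derivable1_diffP.
exact: (@ex_derive _ _ _ _ _ _ _ (is_derive_weight p s t t0)).
Qed.

(* Up to a constant, the bound is the derivative of the bounded function
   [(t / (1 + t)) `^ (p + 1)], so it is integrable at 0 and at infinity. *)
Lemma weight_le p s t : 0 < t -> 0 <= p + 2 ->
  weight p s t <= expR ((p + 2 - s) ^+ 2 / 2) *
    ((t / (1 + t)) `^ p * (1 + t) ^- 2).
Proof.
move=> t0 p2.
have t1 : 0 < 1 + t by rewrite ltr_wpDl// ltr01.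
have -> : weight p s t = (t / (1 + t)) `^ p *
    ((1 + t) `^ p * expR (- (t ^+ 2) / 2 - s * t)).
  by rewrite mulrA -powRM ?divr_ge0 ?(ltW t0) ?(ltW t1)// divfK// gt_eqF.
rewrite [leRHS]mulrCA ler_wpM2l ?powR_ge0// ler_pdivlMr ?exprn_gt0//.
have -> : (1 + t) `^ p * expR (- (t ^+ 2) / 2 - s * t) * (1 + t) ^+ 2 =
    (1 + t) `^ (p + 2) * expR (- (t ^+ 2) / 2 - s * t).
  rewrite powRD ?(gt_eqF t1) ?implybT//.
  by rewrite (@powR_mulrn _ _ 2) ?ltW// mulrAC.
(* Bounding [1 + t] by [expR t] leaves a quadratic exponent in [t], whose maximum is found by
   completing the square. *)
apply: (@le_trans _ _ (expR t `^ (p + 2) * expR (- (t ^+ 2) / 2 - s * t))).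
  rewrite ler_wpM2r ?expR_ge0// ge0_ler_powR ?nnegrE ?expR_ge0 ?(ltW t1)//.
  exact: expR_ge1Dx.
rewrite -expRM -expRD ler_expR.
have := sqr_ge0 (p + 2 - s - t); lra.
Qed.

Lemma integrable_weight p s : -1 < p ->
  mu.-integrable Rpos (EFin \o weight p s).
Proof.
move=> p1.
(* The factor [p + 1], positive here, makes [g] the exact derivative of a function with values
   between 0 and 1. *)
pose g t : R := (p + 1) * ((t / (1 + t)) `^ p * (1 + t) ^- 2).
have intg : mu.-integrable Rpos (EFin \o g).
  have u0 t : 0 < t -> 0 < t / (1 + t).
    by move=> t0; rewrite divr_gt0// ltr_wpDl// ltr01.
  have du t : 0 < t -> is_derive t 1 (fun t => t / (1 + t)) ((1 + t) ^- 2).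
    move=> t0; have t1 : 1 + t != 0 by rewrite gt_eqF// ltr_wpDl// ltr01.
    have d1 : is_derive t 1 (fun t : R => (1 + t)^-1) (- (1 + t) ^- 2 *: 1).
      apply: is_deriveV => //.
      by apply: is_derive_eq; rewrite add0r.
    apply: is_derive_eq; rewrite /GRing.scale/=; field.
    exact: t1.
  apply: (@integrable_bounded_primitive _ g
      (fun t : R => (t / (1 + t)) `^ (p + 1)) 1).
  - move=> t t0; rewrite /g.
    have t1 : 1 + t != 0 by rewrite gt_eqF// ltr_wpDl// ltr01.
    apply: continuousM; first exact: cst_continuous.
    have cu : {for t, continuous (fun t : R => t / (1 + t))}.
      apply: differentiable_continuous; apply/derivable1_diffP.
      exact: (@ex_derive _ _ _ _ _ _ _ (du t t0)).
    apply: continuousM.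
      apply: (@continuous_comp _ _ _ (fun t : R => t / (1 + t)) (fun u : R => u `^ p)) => //.
      apply: differentiable_continuous; apply/derivable1_diffP.
      exact: (@ex_derive _ _ _ _ _ _ _ (is_derive1_powR p (u0 t t0))).
    apply: continuousV; first by rewrite expf_neq0.
    apply: (@continuous_comp _ _ _ (fun t : R => 1 + t) (fun u : R => u ^+ 2));
      last exact: exprn_continuous.
    apply: continuousD; [exact: cst_continuous|exact: cvg_id].
  - move=> t t0.
    have := @is_derive1_comp _ _ (fun t : R => t / (1 + t)) _ _ _
      (is_derive1_powR (p + 1) (u0 t t0)) (du t t0).
    by rewrite addrK /g mulrA.
  - move=> t t0; rewrite mulr_ge0//; first lra.
    by rewrite mulr_ge0 ?powR_ge0// invr_ge0 sqr_ge0.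
  - move=> t t0; rewrite ger0_norm ?powR_ge0//.
    apply: (@le_trans _ _ (1 `^ (p + 1))); last by rewrite powR1.
    rewrite ge0_ler_powR ?nnegrE ?(ltW (u0 t t0))//; first lra.
    by rewrite ler_pdivrMr ?mul1r ?lerDr// ltr_wpDl// ltr01.
(* Dividing by [p + 1] undoes the normalisation of [g], so that [k * g t] is the bound of
   [weight_le]. *)
pose k : R := expR ((p + 2 - s) ^+ 2 / 2) / (p + 1).
have intZ : mu.-integrable Rpos (fun t => (k%:E * (EFin \o g) t)%E).
  exact: integrableZl.
apply: le_integrable intZ => //.
- apply/measurable_EFinP.
  apply: (@measurable_fun_half_line R (weight p s)) => t t0.
  exact: continuous_weight.
- move=> t; rewrite /= in_itv/= andbT => t0.
  rewrite lee_fin (ger0_norm (ltW (weight_gt0 _ _ _ t0))).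
  apply: (@le_trans _ _ (k * g t)); last exact: ler_norm.
  rewrite (le_trans (weight_le _ _ _ t0 _)) // /k /g; first lra.
  by rewrite [leRHS]mulrA divfK// gt_eqF//; lra.
Qed.

End weight.

(** * Moments of the weight: recurrence and positivity *)

Section pcf_int.
Local Open Scope classical_set_scope.
Context {R : realType}.
Notation mu := (@lebesgue_measure R).
Local Notation Rpos := (`]0%R, +oo[%classic : set R).
Implicit Types (p s t a x : R).

(** Here [t <= expR t], and the square is completed with [p + 1] in place of [p]; the extra unit is
    what leaves the factor [expR (- t)], hence decay at infinity. *)
Lemma weight_le_decay p s t : 0 < t -> 0 <= p ->
  weight p s t <= expR ((p + 1 - s) ^+ 2 / 2) * expR (- t).
Proof.
move=> t0 p0; apply: (@le_trans _ _ (expR t `^ p * expR (- (t ^+ 2) / 2 - s * t))).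
  rewrite ler_wpM2r ?expR_ge0// ge0_ler_powR ?nnegrE ?expR_ge0 ?(ltW t0)//.
  by rewrite (le_trans _ (expR_ge1Dx t))// lerDr.
rewrite -expRM -!expRD ler_expR.
have := sqr_ge0 (p + 1 - s - t); lra.
Qed.

Lemma cvg_weight_at0 p s : 0 < p ->
  weight p s n.+2%:R^-1 @[n --> \oo] --> (0 : R).
Proof.
move=> p0.
have h : weight p s t @[t --> 0^'+] --> (0 : R).
  rewrite -[X in _ --> X](mul0r (expR (- (0 ^+ 2) / 2 - s * 0))).
  apply: cvgM; first exact: powR_cvg0.
  apply: cvg_at_right_filter.
  apply: (@continuous_comp _ _ _ (fun t : R => - (t ^+ 2) / 2 - s * t) expR).
    apply: differentiable_continuous; exact/derivable1_diffP.
  exact: continuous_expR.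
apply: ((cvg_at_rightP _ _ _).1 h) ; split=> [n|]; first by rewrite invr_gt0.
have := @cvg_harmonic R; rewrite -cvg_shiftS; exact.
Qed.

Lemma cvg_weight_aty p s : 0 < p ->
  weight p s n.+2%:R @[n --> \oo] --> (0 : R).
Proof.
move=> p0.
have ny : (n.+2%:R : R) @[n --> \oo] --> +oo.
  apply/cvgryPge => A; near=> n.
  apply: (@le_trans _ _ n%:R); last by rewrite ler_nat -addn2 leq_addr.
  by near: n; exact: nbhs_infty_ger.
have h : expR ((p + 1 - s) ^+ 2 / 2) * expR (- t) @[t --> +oo] --> (0 : R).
  rewrite -[X in _ --> X](mulr0 (expR ((p + 1 - s) ^+ 2 / 2))).
  by apply: cvgM; [exact: cvg_cst|exact: cvgr_expR].
have /= h' := cvg_comp _ _ ny h.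
apply: squeeze_cvgr; [|exact: cvg_cst|exact: h'].
apply: nearW => n; rewrite ltW ?weight_gt0// weight_le_decay// ltW//.
Unshelve. all: by end_near. Qed.

(** The endpoint 0 is a null set; dropping it lets everything be checked for [0 < t] only. *)
Lemma pcf_intE a s : - 2^-1 < a ->
  pcf_int a s = Rintegral mu Rpos (weight (a - 2^-1) s).
Proof.
move=> a0; rewrite /pcf_int -Rintegral_itv_obnd_cbnd//.
apply: integrable_weight; lra.
Qed.

Lemma integrable_weightZ (c : R) p s : -1 < p ->
  mu.-integrable Rpos (EFin \o (fun t => c * weight p s t)).
Proof.
move=> p1.
exact: (@integrableZl _ _ _ mu Rpos _ c _ (integrable_weight _ s p1)).
Qed.

Lemma integrable_weight_comb (c0 c1 c2 : R) p s : -1 < p ->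
  mu.-integrable Rpos (EFin \o
    (fun t => c0 * weight p s t + c1 * weight (p + 1) s t + c2 * weight (p + 2) s t)).
Proof.
move=> p1.
have i0 := integrable_weightZ c0 _ s p1.
have i1 : mu.-integrable Rpos (EFin \o (fun t => c1 * weight (p + 1) s t)).
  by apply: integrable_weightZ; lra.
have i2 : mu.-integrable Rpos (EFin \o (fun t => c2 * weight (p + 2) s t)).
  by apply: integrable_weightZ; lra.
have i01 := @integrableD _ _ _ mu Rpos _ _ _ i0 i1.
exact: (@integrableD _ _ _ mu Rpos _ _ _ (i01 _) i2).
Qed.

(** The recurrence and the quadratic form below are both integrals of such a combination of three
    consecutive moments. *)
Lemma Rintegral_weight_comb (c0 c1 c2 : R) a s : - 2^-1 < a ->
  Rintegral mu Rpos (fun t => c0 * weight (a - 2^-1) s t +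
    c1 * weight (a - 2^-1 + 1) s t + c2 * weight (a - 2^-1 + 2) s t) =
  c0 * pcf_int a s + c1 * pcf_int (a + 1) s + c2 * pcf_int (a + 2) s.
Proof.
move=> a0.
have a1 : - 2^-1 < a + 1 by lra.
have a2 : - 2^-1 < a + 2 by lra.
rewrite !pcf_intE//.
rewrite (_ : a + 1 - 2^-1 = a - 2^-1 + 1); last by ring.
rewrite (_ : a + 2 - 2^-1 = a - 2^-1 + 2); last by ring.
have p1 : -1 < a - 2^-1 by lra.
set p := a - 2^-1 in p1 *.
have i (q : R) : p <= q -> mu.-integrable Rpos (EFin \o weight q s).
  by move=> pq; apply: integrable_weight; lra.
have iZ (c q : R) : p <= q -> mu.-integrable Rpos (EFin \o (fun t => c * weight q s t)).
  by move=> pq; apply: integrable_weightZ; lra.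
rewrite RintegralD//; last 2 first.
- have i1 : mu.-integrable Rpos (EFin \o (fun t => c1 * weight (p + 1) s t)).
    by apply: iZ; lra.
  exact: (@integrableD _ _ _ mu Rpos _ _ _ (iZ c0 p (lexx p)) i1).
- by apply: iZ; lra.
rewrite RintegralD//; [|by apply: iZ; lra..].
by rewrite !RintegralZl//; apply: i; lra.
Qed.

(** The integrand of the difference of the two sides is the derivative of [weight (a + 2^-1) s],
    which tends to 0 at both ends because its exponent is positive. *)
Lemma pcf_int_rec a s : - 2^-1 < a ->
  (a + 2^-1) * pcf_int a s = s * pcf_int (a + 1) s + pcf_int (a + 2) s.
Proof.
move=> a0; apply/eqP; rewrite -subr_eq0.
have -> : (a + 2^-1) * pcf_int a s - (s * pcf_int (a + 1) s + pcf_int (a + 2) s) =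
  (a + 2^-1) * pcf_int a s + (- s) * pcf_int (a + 1) s + (- 1) * pcf_int (a + 2) s.
  by rewrite !mulNr mul1r opprD addrA.
rewrite -Rintegral_weight_comb//; apply/eqP.
apply: (@Rintegral_derivative_eq0 _ _ (weight (a + 2^-1) s)).
- move=> t t0.
  have cw (c p : R) : {for t, continuous (fun t => c * weight p s t)}.
    by apply: continuousM; [exact: cst_continuous|exact: continuous_weight].
  apply: (@continuousD _ _ _ (fun t => _ * weight _ s t + _ * weight _ s t)
     (fun t => _ * weight _ s t)); last exact: cw.
  by apply: (@continuousD _ _ _ (fun t => _ * weight _ s t)
     (fun t => _ * weight _ s t)); exact: cw.
- move=> t t0; have := is_derive_weight (a + 2^-1) s t t0.
  rewrite (_ : a - 2^-1 = a + 2^-1 - 1); last by field.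
  rewrite subrK (_ : a + 2^-1 - 1 + 2 = a + 2^-1 + 1); last by ring.
  by move=> h; apply: is_derive_eq; ring.
- by apply: integrable_weight_comb; lra.
- by apply: cvg_weight_aty; lra.
- by apply: cvg_weight_at0; lra.
Qed.

Lemma lebesgue_measure_itvoy_gt0 (l : R) : (0 < mu `]l, +oo[)%E.
Proof. by rewrite lebesgue_measure_itv/= ltry addye// lt0y. Qed.

Lemma pcf_int_gt0 a s : - 2^-1 < a -> 0 < pcf_int a s.
Proof.
move=> a0; rewrite pcf_intE//; apply: Rintegral_gt0 => //.
- exact: lebesgue_measure_itvoy_gt0.
- by apply: integrable_weight; lra.
- by move=> t; rewrite /= in_itv/= andbT; exact: weight_gt0.
Qed.

Lemma pcf_int_ltN a x : - 2^-1 < a -> 0 < x -> pcf_int a x < pcf_int a (- x).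
Proof.
move=> a0 x0; have p1 : -1 < a - 2^-1 by lra.
have i1 := integrable_weight _ x p1.
have i2 := integrable_weight _ (- x) p1.
rewrite -subr_gt0 !pcf_intE// -RintegralB//; apply: Rintegral_gt0 => //.
- exact: lebesgue_measure_itvoy_gt0.
- exact: (@integrableB _ _ _ mu Rpos _ _ _ i2 i1).
- move=> t; rewrite /= in_itv/= andbT => t0.
  rewrite subr_gt0 /weight ltr_pM2l ?powR_gt0// ltr_expR.
  by have := mulr_gt0 x0 t0; lra.
Qed.

(** The expression is the integral of [(t - l) ^+ 2] against the weight. *)
Lemma pcf_int_quad_gt0 a s (l : R) : - 2^-1 < a ->
  0 < l ^+ 2 * pcf_int a s - 2 * l * pcf_int (a + 1) s + pcf_int (a + 2) s.
Proof.
move=> a0.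
have -> : l ^+ 2 * pcf_int a s - 2 * l * pcf_int (a + 1) s + pcf_int (a + 2) s =
   l ^+ 2 * pcf_int a s + (- (2 * l)) * pcf_int (a + 1) s + 1 * pcf_int (a + 2) s.
  by rewrite mulNr mul1r.
rewrite -Rintegral_weight_comb//.
set f := (X in Rintegral _ _ X).
have fE t : 0 < t -> f t = (t - l) ^+ 2 * weight (a - 2^-1) s t.
  move=> t0; rewrite /f (_ : a - 2^-1 + 2 = a - 2^-1 + 1 + 1); last by ring.
  by rewrite !weightD1//; ring.
have intf : mu.-integrable Rpos (EFin \o f).
  by apply: integrable_weight_comb; lra.
have sub : `]`|l|, +oo[ `<=` Rpos.
  by apply: subset_itvr; rewrite bnd_simp.
(* The integrand vanishes at [t = l], possibly inside the half-line. Beyond the absolute value of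
   [l] it is strictly positive, and elsewhere it is nonnegative. *)
apply: (@lt_le_trans _ _ (Rintegral mu `]`|l|, +oo[ f)).
  apply: Rintegral_gt0 => //.
  - exact: lebesgue_measure_itvoy_gt0.
  - exact: integrableS intf.
  - move=> t; rewrite /= in_itv/= andbT => lt.
    have t0 : 0 < t by exact: le_lt_trans lt.
    rewrite fE// mulr_gt0 ?weight_gt0// exprn_even_gt0//= subr_eq0.
    by rewrite gt_eqF// (le_lt_trans (ler_norm _)).
rewrite /Rintegral fine_le//.
- by apply: integrable_fin_num => //; exact: integrableS intf.
- exact: integrable_fin_num.
- apply: ge0_subset_integral => //; first exact: measurable_int intf.
  move=> t; rewrite /= in_itv/= andbT => t0; rewrite lee_fin fE//.
  by rewrite mulr_ge0 ?sqr_ge0// ltW// weight_gt0.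
Qed.

End pcf_int.

(** * Ratios of second parabolic cylinder functions *)

Section pcfV.
Context {R : realType}.
Implicit Types (a x n : R).

Definition pcfW a x : R := sin (pi * a) * pcf_int a x + pcf_int a (- x).

Lemma pcfV_ratio a b x : pcfV a x / pcfV b x = pcfW a x / pcfW b x.
Proof.
rewrite /pcfV -/(pcfW a x) -/(pcfW b x) -mulf_div divff ?mul1r//.
by rewrite mulf_neq0 ?invr_eq0 ?gt_eqF ?expR_gt0 ?pi_gt0.
Qed.

Lemma sin_piD1 a : sin (pi * (a + 1)) = - sin (pi * a).
Proof. by rewrite mulrDr mulr1 sinDpi. Qed.

Lemma sin_pi_gt0 (k : nat) a : (2 * k)%:R < a < (2 * k)%:R + 1 -> 0 < sin (pi * a).
Proof.
elim: k a => [|k IHk] a.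
  rewrite muln0 add0r => /andP[a0 a1].
  rewrite sin_gt0_pi// mulr_gt0 ?pi_gt0//= -[ltRHS]mulr1 ltr_pM2l//; exact: pi_gt0.
rewrite mulnS natrD => /andP[h1 h2].
have -> : a = a - 2 + 1 + 1 by ring.
by rewrite !sin_piD1 opprK; apply: IHk; apply/andP; split; lra.
Qed.

(** The two integrals obey recurrences whose middle terms have opposite signs; the sign change of
    the sine under [a + 1] reconciles them. *)
Lemma pcfW_rec a x : - 2^-1 < a ->
  pcfW (a + 2) x = (a + 2^-1) * pcfW a x + x * pcfW (a + 1) x.
Proof.
move=> a0; rewrite /pcfW sin_piD1.
have -> : sin (pi * (a + 2)) = sin (pi * a).
  by rewrite (_ : a + 2 = a + 1 + 1) ?sin_piD1 ?opprK//; ring.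
have := pcf_int_rec _ x a0; have := pcf_int_rec _ (- x) a0.
move: (pcf_int (a + 2) x) (pcf_int (a + 2) (- x)) (pcf_int (a + 1) x)
  (pcf_int (a + 1) (- x)) (pcf_int a x) (pcf_int a (- x)) (sin _).
move=> I2 J2 I1 J1 I0 J0 s hJ hI.
have -> : I2 = (a + 2^-1) * I0 - x * I1 by rewrite hI addrC addKr.
have -> : J2 = (a + 2^-1) * J0 + x * J1 by rewrite hJ; ring.
by ring.
Qed.

(* For [0 <= sin (pi * a)] the numbers [pcfW (a + j) x] are the moments of a
   positive measure on the real line, so this is the Cauchy-Schwarz inequality. *)
Lemma pcfW_sqr_lt a x : - 2^-1 < a -> 0 <= sin (pi * a) ->
  0 < pcfW a x /\ pcfW (a + 1) x ^+ 2 < pcfW a x * pcfW (a + 2) x.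
Proof.
move=> a0 s0.
have W0 : 0 < pcfW a x.
  by rewrite ltr_wpDl ?pcf_int_gt0// mulr_ge0// ltW// pcf_int_gt0.
split=> //.
(* This [l] minimises the quadratic form below, so positivity there is the full Cauchy-Schwarz
   inequality. *)
have [l lE] : {l | pcfW (a + 1) x = l * pcfW a x}.
  by exists (pcfW (a + 1) x / pcfW a x); rewrite divfK// gt_eqF.
(* Of the measure on the line, the half with [s = x] is reflected to negative [t], so its form is
   taken at [- l]; the other half is taken at [l]. *)
have q : 0 < l ^+ 2 * pcfW a x - 2 * l * pcfW (a + 1) x + pcfW (a + 2) x.
  have hJ := pcf_int_quad_gt0 _ (- x) l a0.
  have := mulr_ge0 s0 (ltW (pcf_int_quad_gt0 _ x (- l) a0)).
  rewrite /pcfW sin_piD1.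
  have -> : sin (pi * (a + 2)) = sin (pi * a).
    by rewrite (_ : a + 2 = a + 1 + 1) ?sin_piD1 ?opprK//; ring.
  move: hJ; move: (pcf_int (a + 2) x) (pcf_int (a + 2) (- x)) (pcf_int (a + 1) x)
    (pcf_int (a + 1) (- x)) (pcf_int a x) (pcf_int a (- x)) (sin _).
  by move=> I2 J2 I1 J1 I0 J0 s; lra.
move: q; rewrite lE; move: W0.
move: (pcfW a x) (pcfW (a + 2) x) => u v u0 q.
have : 0 < u * (v - l ^+ 2 * u) by rewrite mulr_gt0//; lra.
lra.
Qed.

(** Completing the square bounds [(r * 2 - x) ^+ 2] by the discriminant. *)
Lemma quadratic_root_lt (x c r : R) : r ^+ 2 < c + x * r ->
  r < (x + Num.sqrt (4 * c + x ^+ 2)) / 2.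
Proof.
move=> h; rewrite ltr_pdivlMr//; rewrite -ltrBlDl.
apply: (le_lt_trans (ler_norm _)); rewrite -sqrtr_sqr ltr_sqrt; last first.
  by apply: (le_lt_trans (sqr_ge0 (r * 2 - x))); lra.
lra.
Qed.

Lemma pcfW_ratio_lt a x : - 2^-1 < a -> 0 <= sin (pi * a) ->
  pcfW (a + 1) x / pcfW a x < (x + Num.sqrt (4 * (a + 2^-1) + x ^+ 2)) / 2.
Proof.
move=> a0 s0; have [W0 h] := pcfW_sqr_lt _ x a0 s0.
apply: quadratic_root_lt; rewrite expr_div_n ltr_pdivrMr ?exprn_gt0//.
apply: (lt_le_trans h); rewrite pcfW_rec//.
rewrite le_eqVlt; apply/orP; left; apply/eqP.
move: W0; move: (pcfW a x) (pcfW (a + 1) x) => u v u0.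
by field; rewrite gt_eqF.
Qed.

(** This covers negative sines as well: the sine is at least -1, and the integral at [x] is smaller
    than the one at [- x]. The lower bound needs it at [a + 1], where the sine has changed sign. *)
Lemma pcfW_gt0 a x : - 2^-1 < a -> 0 < x -> 0 < pcfW a x.
Proof.
move=> a0 x0; rewrite /pcfW.
have h1 := pcf_int_gt0 _ x a0; have h2 := pcf_int_ltN _ _ a0 x0.
have h3 := sin_geN1 (pi * a).
have : 0 <= (sin (pi * a) + 1) * pcf_int a x by rewrite mulr_ge0 ?(ltW h1)//; lra.
by rewrite mulrDl mul1r; lra.
Qed.

(** The positive root [L] is a fixed point of the map sending [q] to [x + c / q], which is
    decreasing on positive [q]. *)
Lemma quadratic_root_flip (x c q : R) : 0 < c -> 0 < q ->
  q < (x + Num.sqrt (4 * c + x ^+ 2)) / 2 ->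
  (x + Num.sqrt (4 * c + x ^+ 2)) / 2 < x + c / q.
Proof.
move=> c0 q0; set S := Num.sqrt _ => h.
have S2 : S ^+ 2 = 4 * c + x ^+ 2.
  by rewrite sqr_sqrtr// addr_ge0 ?sqr_ge0//; lra.
have l0 := lt_trans q0 h.
set L := (x + S) / 2 in h l0 *.
have e : L = x + c / L.
  apply: (@mulIf _ L); first by rewrite gt_eqF.
  by rewrite [RHS]mulrDl divfK ?gt_eqF// /L; lra.
by rewrite [ltLHS]e ltrD2l ltr_pM2l// ltf_pV2 ?posrE.
Qed.

Lemma pcfV_ratio_upper (k : nat) n x : (0 < k)%N -> 0 < x ->
  (2 * k)%:R - 1 < n < (2 * k)%:R ->
  pcfV n x / pcfV (n - 1) x < (x + Num.sqrt (4 * n - 2 + x ^+ 2)) / 2.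
Proof.
case: k => // k _ x0; rewrite mulnS natrD => /andP[n1 n2].
have k0 : 0 <= (2 * k)%:R :> R by [].
(* With [k] replaced by [k.+1], the base index [n - 1] lies between [2 * k] and [2 * k + 1], where
   the sine is positive. *)
rewrite pcfV_ratio -[in pcfW n x](subrK 1 n).
rewrite (_ : 4 * n - 2 = 4 * (n - 1 + 2^-1)); last by field.
apply: pcfW_ratio_lt; first lra.
by apply/ltW/(@sin_pi_gt0 k); apply/andP; split; lra.
Qed.

Lemma pcfV_ratio_lower (k : nat) n x : (0 < k)%N -> 0 < x ->
  (2 * k)%:R < n < (2 * k)%:R + 1 ->
  (x + Num.sqrt (4 * n - 6 + x ^+ 2)) / 2 < pcfV n x / pcfV (n - 1) x.
Proof.
case: k => // k _ x0; rewrite mulnS natrD => /andP[n1 n2].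
have k0 : 0 <= (2 * k)%:R :> R by [].
(* The base index is now [n - 2]: the upper bound for the ratio at [a + 1] over [a] is flipped into
   one for [a + 2] over [a + 1]. *)
have [a an] : {a | n = a + 2} by exists (n - 2); rewrite subrK.
subst n; rewrite pcfV_ratio (_ : a + 2 - 1 = a + 1); last by ring.
have a0 : - 2^-1 < a by lra.
have a1 : - 2^-1 < a + 1 by lra.
have s0 : 0 <= sin (pi * a).
  by apply/ltW/(@sin_pi_gt0 k); apply/andP; split; lra.
have W0 := pcfW_gt0 _ _ a0 x0; have W1 := pcfW_gt0 _ _ a1 x0.
have := pcfW_ratio_lt _ x a0 s0.
move=> /(quadratic_root_flip _ _ _ _ _) h.
rewrite pcfW_rec// (_ : 4 * (a + 2) - 6 = 4 * (a + 2^-1)); last by field.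
have -> : ((a + 2^-1) * pcfW a x + x * pcfW (a + 1) x) / pcfW (a + 1) x =
    x + (a + 2^-1) / (pcfW (a + 1) x / pcfW a x).
  move: W0 W1 {h}; move: (pcfW a x) (pcfW (a + 1) x) => u v u0 v0.
  by field; rewrite !gt_eqF.
by apply: h; [lra|rewrite divr_gt0].
Qed.

End pcfV.

(** * Real polynomials for Hermite values on the imaginary axis *)

Section hermite_imaginary.
Context {R : realType}.
Implicit Types (x : R) (n k : nat).

(* [ihermite n] is [i^-n H_n(i X)], which has real coefficients. *)
Fixpoint ihermite n : {poly R} :=
  match n with
  | 0 => 1
  | 1 => 2%:R *: 'X
  | (n'.+1 as m).+1 => 2%:R *: 'X * ihermite m + (2 * m)%:R *: ihermite n'
  end.

Lemma ihermiteSS n :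
  ihermite n.+2 = 2%:R *: 'X * ihermite n.+1 + (2 * n.+1)%:R *: ihermite n.
Proof. by []. Qed.

Lemma deriv_ihermiteS n : (ihermite n.+1)^`() = (2 * n.+1)%:R *: ihermite n.
Proof.
suff [] : (ihermite n.+1)^`() = (2 * n.+1)%:R *: ihermite n /\
  (ihermite n.+2)^`() = (2 * n.+2)%:R *: ihermite n.+1 by [].
elim: n => [|n [IH1 IH2]].
  rewrite ihermiteSS /= !poly.derivE; split; first by rewrite alg_polyC.
  by rewrite !scaler_nat; ring.
split=> //; rewrite ihermiteSS derivD derivM IH2 !derivZ IH1 derivX.
by rewrite [ihermite n.+2]ihermiteSS !scaler_nat; ring.
Qed.

(** A coefficientwise substitute for nonnegativity on the half-line: it is stable under products and
    passes from a derivative back to the polynomial once the constant term is nonnegative. *)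
Definition coef_nneg (p : {poly R}) := forall j, 0 <= p`_j.

Lemma coef_nnegZ (c : R) (p : {poly R}) : 0 <= c -> coef_nneg p -> coef_nneg (c *: p).
Proof. by move=> c0 p0 j; rewrite coefZ mulr_ge0. Qed.

Lemma coef_nnegM (p q : {poly R}) : coef_nneg p -> coef_nneg q -> coef_nneg (p * q).
Proof. by move=> p0 q0 j; rewrite coefM sumr_ge0// => l _; rewrite mulr_ge0. Qed.

Lemma coef_nnegX : coef_nneg 'X.
Proof. by move=> j; rewrite coefX. Qed.

Lemma ihermite_nneg n : coef_nneg (ihermite n).
Proof.
suff [] : coef_nneg (ihermite n) /\ coef_nneg (ihermite n.+1) by [].
have X2 : coef_nneg (2%:R *: 'X) by apply: coef_nnegZ => //; exact: coef_nnegX.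
elim: n => [|n [IH1 IH2]]; first by split=> // j; rewrite coef1.
split=> // j; rewrite ihermiteSS coefD addr_ge0//; first exact: coef_nnegM.
exact: coef_nnegZ.
Qed.

Lemma horner_nneg (p : {poly R}) x : coef_nneg p -> 0 <= x -> 0 <= p.[x].
Proof.
move=> p0 x0; rewrite horner_coef sumr_ge0// => j _.
by rewrite mulr_ge0 ?exprn_ge0.
Qed.

Lemma coef_nneg_of_deriv (p : {poly R}) : 0 <= p`_0 -> coef_nneg p^`() -> coef_nneg p.
Proof.
by move=> p0 dp [|j]//; have := dp j; rewrite coef_deriv pmulrn_lge0.
Qed.

Lemma ihermiteE n x : (ihermite n.+2).[x] =
  2 * x * (ihermite n.+1).[x] + 2 * n.+1%:R * (ihermite n).[x].
Proof. by rewrite ihermiteSS !hornerE natrM. Qed.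

Lemma ihermite_odd0 k : (ihermite (2 * k).+1).[0] = 0.
Proof.
elim: k => [|k IHk]; first by rewrite muln0 /= !hornerE.
by rewrite mulnS ihermiteE IHk; ring.
Qed.

(* The difference of the two sides has derivative [8 n x h_(n-1)(x)^2], where
   [n = 2 k + 2] and [h_j] is [ihermite j]. *)
Lemma ihermite_sqr_ge k x : 0 <= x ->
  2 * (2 * k).+2%:R * (ihermite (2 * k).+1).[x] ^+ 2 <= (ihermite (2 * k).+2).[x] ^+ 2.
Proof.
move=> x0; rewrite -subr_ge0.
pose E := ihermite (2 * k).+2 ^+ 2 - (2 * (2 * k).+2%:R) *: ihermite (2 * k).+1 ^+ 2.
suff /horner_nneg /(_ x0) : coef_nneg E by rewrite /E !hornerE.
apply: coef_nneg_of_deriv.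
  rewrite -horner_coef0 (_ : E.[0] = (ihermite (2 * k).+2).[0] ^+ 2) ?sqr_ge0//.
  by rewrite /E !(hornerD, hornerN, hornerZ, horner_exp) ihermite_odd0; ring.
(* With [n = 2 k + 2], the recurrence replaces [h_n - 2(n-1) h_(n-2)] by [2 x h_(n-1)], which
   completes a square. *)
have -> : E^`() = (8 * (2 * k).+2%:R) *: ('X * ihermite (2 * k).+1 ^+ 2).
  rewrite /E derivB derivZ !expr2 !derivM !deriv_ihermiteS ihermiteSS.
  by rewrite -!natrM !scaler_nat; ring.
apply: coef_nnegZ => //; apply: coef_nnegM; first exact: coef_nnegX.
by rewrite expr2; apply: coef_nnegM; exact: ihermite_nneg.
Qed.

Lemma ihermite_gt0 n x : 0 < x -> 0 < (ihermite n).[x].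
Proof.
move=> x0; suff /andP[] : (0 < (ihermite n).[x]) && (0 < (ihermite n.+1).[x]) by [].
elim: n => [|n /andP[IH1 IH2]]; first by rewrite /= !hornerE ltr01/= mulr_gt0.
by rewrite IH2 ihermiteE addr_gt0// mulr_gt0// mulr_gt0.
Qed.

Lemma ihermite_turan k x : 0 <= x ->
  (ihermite (2 * k).+1).[x] ^+ 2 < (ihermite (2 * k)).[x] * (ihermite (2 * k).+2).[x].
Proof.
move=> x0; elim: k => [|k IHk].
  rewrite muln0 ihermiteE.
  have -> : (ihermite 1).[x] = 2 * x by rewrite /= hornerZ hornerX.
  have -> : (ihermite 0).[x] = 1 by rewrite /= hornerC.
  lra.
have := ihermite_sqr_ge k _ x0; move: IHk; rewrite mulnS !addSn add0n.
move: (2 * k)%N => N.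
rewrite (ihermiteE N.+2) (ihermiteE N.+1) (ihermiteE N).
rewrite -[N.+3]addn3 -[N.+2]addn2 -[N.+1]addn1 !natrD.
have N0 : 0 <= N%:R :> R by [].
move: N0; move: N%:R (ihermite N).[x] (ihermite (N + 1)).[x] => m a b m0 h1 h2.
(* For [n = m + 2] this is the term [4n(n-1) D_(n-2)]; adding twice [h2] gives [D_n > 0]. *)
have : 0 < 4 * (m + 2) * (m + 1) * (a * (2 * x * b + 2 * (m + 1) * a) - b ^+ 2).
  by rewrite mulr_gt0 ?subr_gt0// mulr_gt0 ?mulr_gt0//; lra.
lra.
Qed.

Lemma ihermite_ratio_upper k x : 0 < x ->
  (ihermite (2 * k).+1).[x] / (ihermite (2 * k)).[x] <
    x + Num.sqrt (4 * k%:R + 2 + x ^+ 2).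
Proof.
move=> x0; have := ihermite_turan k _ (ltW x0); rewrite ihermiteE.
have := ihermite_gt0 (2 * k) _ x0; rewrite -[(2 * k).+1%:R]natr1 natrM.
move: (ihermite (2 * k)).[x] (ihermite (2 * k).+1).[x] => a b a0 h.
rewrite (_ : 4 * k%:R + 2 = 4 * (k%:R + 2^-1)); last by field.
(* Half the ratio satisfies the quadratic inequality with constant [k + 1/2], the same shape as for
   [pcfW]. *)
rewrite -(@ltr_pM2r _ 2^-1) ?invr_gt0//.
apply: quadratic_root_lt.
have : (b / a) ^+ 2 < 2 * x * (b / a) + 2 * (2 * k%:R + 1).
  rewrite -(@ltr_pM2r _ (a ^+ 2)) ?exprn_gt0// -exprMn divfK ?gt_eqF//.
  rewrite [ltRHS](_ : _ = a * (2 * x * b + 2 * (2 * k%:R + 1) * a))//.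
  by field; rewrite gt_eqF.
by move: (b / a) => r; lra.
Qed.

(** By the recurrence, sending [q] to [x + (k + 1/2) / q] carries half of one ratio to half of the
    next, so [quadratic_root_flip] applies. *)
Lemma ihermite_ratio_lower k x : 0 < x ->
  x + Num.sqrt (4 * k%:R + 2 + x ^+ 2) <
    (ihermite (2 * k).+2).[x] / (ihermite (2 * k).+1).[x].
Proof.
move=> x0; have := ihermite_ratio_upper k _ x0; rewrite ihermiteE.
have := ihermite_gt0 (2 * k) _ x0; have := ihermite_gt0 (2 * k).+1 _ x0.
rewrite -[(2 * k).+1%:R]natr1 natrM.
move: (ihermite (2 * k)).[x] (ihermite (2 * k).+1).[x] => a b b0 a0.
rewrite (_ : 4 * k%:R + 2 = 4 * (k%:R + 2^-1)); last by field.
rewrite -(@ltr_pM2r _ 2^-1) ?invr_gt0// => /quadratic_root_flip h.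
rewrite -(@ltr_pM2r _ 2^-1) ?invr_gt0//.
have -> : (2 * x * b + 2 * (2 * k%:R + 1) * a) / b / 2 =
    x + (k%:R + 2^-1) / (b / a / 2).
  by field; rewrite !gt_eqF.
by apply: h; [rewrite ltr_wpDl ?invr_gt0|rewrite !divr_gt0].
Qed.

Lemma ihermiteN n x : (ihermite n).[- x] = (-1) ^+ n * (ihermite n).[x].
Proof.
suff [] : (ihermite n).[- x] = (-1) ^+ n * (ihermite n).[x] /\
  (ihermite n.+1).[- x] = (-1) ^+ n.+1 * (ihermite n.+1).[x] by [].
elim: n => [|n [IH1 IH2]].
  by rewrite /= !(hornerC, hornerZ, hornerX) expr0 expr1; split; ring.
by split=> //; rewrite !ihermiteE IH1 IH2 !exprS; ring.
Qed.

(** After clearing the denominator the terms compare one by one, since [c / e <= 1]. Equality holds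
    at [x = 0]. *)
Lemma sqrt_ratio_le (c e x : R) : 0 < c -> c <= e -> 0 <= x ->
  Num.sqrt (c / e) <= (x + Num.sqrt (c + x ^+ 2)) / (x + Num.sqrt (e + x ^+ 2)).
Proof.
move=> c0 ce x0; have e0 := lt_le_trans c0 ce.
have S0 : 0 < Num.sqrt (e + x ^+ 2).
  by rewrite sqrtr_gt0 ltr_wpDr ?sqr_ge0.
rewrite ler_pdivlMr; last by rewrite ltr_wpDl.
have ce1 : c / e <= 1 by rewrite ler_pdivrMr ?mul1r.
rewrite mulrDr lerD//.
  by rewrite ler_piMl// -sqrtr1 ler_sqrt ?ltr01.
rewrite -sqrtrM ?divr_ge0 ?(ltW c0) ?(ltW e0)//.
rewrite ler_sqrt; last by rewrite addr_ge0 ?sqr_ge0 ?(ltW c0).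
by rewrite mulrDr divfK ?gt_eqF// lerD2l ler_piMl ?sqr_ge0.
Qed.

(** The right side is a quotient of consecutive ratios: the numerator is bounded below with index
    [k], the denominator above with [k.+1]. At the excluded point 0 both odd-index factors
    vanish. *)
Lemma ihermite_turan_ratio k x : x != 0 ->
  Num.sqrt ((k.+1%:R - 2^-1) / (k.+1%:R + 2^-1)) <
  (ihermite (2 * k).+2).[x] ^+ 2 /
    ((ihermite (2 * k).+1).[x] * (ihermite (2 * k).+3).[x]).
Proof.
(* The right side is even in [x], as the signs of the two odd factors cancel. *)
wlog x0 : x / 0 < x => [hw|_].
  move=> xn0; have [x0|x0] := ltP 0 x; first exact: hw.
  have := hw (- x); rewrite oppr_gt0 oppr_eq0 lt_neqAle xn0 x0 => /(_ isT isT).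
  rewrite !ihermiteN -[(-1) ^+ (2 * k).+1]signr_odd -[(-1) ^+ (2 * k).+2]signr_odd.
  by rewrite -[(-1) ^+ (2 * k).+3]signr_odd /= oddM/= expr1 !mulN1r mul1r mulrNN.
have h1 := ihermite_ratio_lower k _ x0; have := ihermite_ratio_upper k.+1 _ x0.
have := ihermite_gt0 (2 * k).+1 _ x0; have := ihermite_gt0 (2 * k).+2 _ x0.
have := ihermite_gt0 (2 * k).+3 _ x0.
rewrite mulnS !addSn add0n; move: h1.
move: (ihermite (2 * k).+1).[x] (ihermite (2 * k).+2).[x] (ihermite (2 * k).+3).[x].
move=> a b c h1 c0 b0 a0 h2.
have k0 : 0 <= k%:R :> R by [].
rewrite -[k.+1%:R]natr1 in h2 *.
have -> : (k%:R + 1 - 2^-1) / (k%:R + 1 + 2^-1) =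
    (4 * k%:R + 2) / (4 * (k%:R + 1) + 2) :> R.
  by field; apply/andP; split; rewrite gt_eqF//; lra.
apply: (le_lt_trans (sqrt_ratio_le _ (4 * (k%:R + 1) + 2) _ _ _ (ltW x0))); try lra.
have -> : b ^+ 2 / (a * c) = (b / a) / (c / b) by field; rewrite !gt_eqF.
have c1 : 0 < c / b by rewrite divr_gt0.
rewrite ltr_pdivlMr// mulrAC ltr_pdivrMr; last exact: lt_trans h2.
apply: ltr_pM => //; rewrite ?(ltW c1)// addr_ge0 ?sqrtr_ge0 ?ltW//.
Qed.

End hermite_imaginary.

(** * Transfer to complex Hermite polynomials *)

Local Open Scope complex_scope.

Lemma hermiteSS (K : nzRingType) (n : nat) : hermite K n.+2 =
  2%:R *: 'X * hermite K n.+1 - (2 * n.+1)%:R *: hermite K n.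
Proof.
by rewrite /hermite /=; case: (hermite_pair K n) => p q.
Qed.

Lemma hermite_imaginary_axis (R : realType) (n : nat) (x : R) :
  (hermite R[i] n).['i * x%:C] = 'i ^+ n * ((ihermite n).[x])%:C.
Proof.
suff [] : (hermite R[i] n).['i * x%:C] = 'i ^+ n * ((ihermite n).[x])%:C /\
  (hermite R[i] n.+1).['i * x%:C] = 'i ^+ n.+1 * ((ihermite n.+1).[x])%:C by [].
elim: n => [|n [IH1 IH2]].
  split; first by rewrite /= !hornerC rmorph1 mulr1.
  rewrite /hermite /= !hornerZ !hornerX rmorphM/= rmorph_nat expr1.
  by rewrite mulrCA.
split=> //; rewrite hermiteSS ihermiteE.
rewrite hornerD hornerN hornerM !hornerZ hornerX IH1 IH2.
rewrite rmorphD !rmorphM/= !rmorph_nat [(2 * n.+1)%:R]natrM !exprS.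
have i2 : 'i * 'i = -1 :> R[i] by rewrite -expr2 sqr_i.
(* Abstracting to a commutative ring with [j * j = -1] leaves an identity whose two sides differ by
   a multiple of [j * j + 1]. *)
suff step (K : comPzRingType) (j u y a b m : K) : j * j = -1 ->
    2 * (j * y) * (j * u * a) - 2 * m * (u * b) = j * (j * u) * (2 * y * a + 2 * m * b).
  exact: step.
move=> j2; apply/eqP; rewrite -subr_eq0.
rewrite [X in X == 0](_ : _ = - (j * j + 1) * (2 * m * u * b)); last by ring.
by rewrite j2 addNr oppr0 mul0r.
Qed.

Section hermite_complex.
Variable R : realType.

Lemma complexi_neq0 : 'i != 0 :> R[i].
Proof. by rewrite eq_complex /= oner_eq0 andbF. Qed.

(** The order on [R[i]] relates only numbers with equal imaginary parts, so the claim includes that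
    the left side is real: the powers of ['i] cancel and leave the ratio of [ihermite] values. *)
Lemma hermite_ratio_upper (k : nat) (x : R) : 0 < x ->
  - 'i * ((hermite R[i] (2 * k).+1).['i * x%:C] / (hermite R[i] (2 * k)).['i * x%:C])
       < (x + Num.sqrt (4 * k%:R + 2 + x ^+ 2))%:C.
Proof.
move=> x0; rewrite !hermite_imaginary_axis exprS.
have := ihermite_ratio_upper k _ x0; rewrite -ltcR; congr (_ < _).
have h0 : ((ihermite (2 * k)).[x])%:C != 0 :> R[i].
  by rewrite fmorph_eq0 gt_eqF// ihermite_gt0.
have i0 : 'i ^+ (2 * k) != 0 :> R[i] by rewrite expf_neq0// complexi_neq0.
have i2 : 'i * 'i = -1 :> R[i] by rewrite -expr2 sqr_i.
suff step (K : fieldType) (j u a b : K) : j * j = -1 -> u != 0 -> b != 0 ->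
    a / b = - j * (j * u * a / (u * b)).
  by rewrite fmorph_div/=; exact: step.
move=> j2 u0 b0; rewrite [RHS](_ : _ = - (j * j) * (a / b)).
  by rewrite j2 opprK mul1r.
by field; rewrite u0 b0.
Qed.

Lemma hermite_ratio_lower (k : nat) (x : R) : 0 < x ->
  'i * ((hermite R[i] (2 * k).+1).['i * x%:C] / (hermite R[i] (2 * k).+2).['i * x%:C])
       < ((x + Num.sqrt (4 * k%:R + 2 + x ^+ 2))^-1)%:C.
Proof.
move=> x0; rewrite !hermite_imaginary_axis [_ ^+ (2 * k).+2]exprS.
have a0 := ihermite_gt0 (2 * k).+1 _ x0; have b0 := ihermite_gt0 (2 * k).+2 _ x0.
have h : (ihermite (2 * k).+1).[x] / (ihermite (2 * k).+2).[x] <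
    (x + Num.sqrt (4 * k%:R + 2 + x ^+ 2))^-1.
  rewrite -invf_div ltf_pV2 ?posrE ?ihermite_ratio_lower// ?divr_gt0//.
  by rewrite ltr_wpDr ?sqrtr_ge0.
move: h; rewrite -ltcR; congr (_ < _).
have h0 : ((ihermite (2 * k).+2).[x])%:C != 0 :> R[i] by rewrite fmorph_eq0 gt_eqF.
have i0 : 'i ^+ (2 * k).+1 != 0 :> R[i] by rewrite expf_neq0// complexi_neq0.
have i1 := complexi_neq0.
suff step (K : fieldType) (j u a b : K) : j != 0 -> u != 0 -> b != 0 ->
    a / b = j * (u * a / (j * u * b)).
  by rewrite fmorph_div/=; exact: step.
by move=> nj nu nb; field; rewrite nj nu nb.
Qed.

Lemma hermite_turan_ratio (k : nat) (x : R) : x != 0 ->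
  (hermite R[i] (2 * k).+2).['i * x%:C] ^+ 2
       / ((hermite R[i] (2 * k).+1).['i * x%:C] * (hermite R[i] (2 * k).+3).['i * x%:C])
       > (Num.sqrt ((k.+1%:R - 2^-1) / (k.+1%:R + 2^-1)))%:C.
Proof.
move=> x0; have := ihermite_turan_ratio k _ x0; rewrite -ltcR; congr (_ < _).
rewrite !hermite_imaginary_axis fmorph_div/= rmorphXn rmorphM/=.
(* The powers of ['i] cancel because the outer indices add up to twice the middle one. *)
suff step (K : fieldType) (w u v a b c : K) : w ^+ 2 = u * v -> w != 0 ->
    b ^+ 2 / (a * c) = (w * b) ^+ 2 / (u * a * (v * c)).
  apply: step; last by rewrite expf_neq0// complexi_neq0.
  by rewrite -exprD -exprM muln2 -addnn !addSn !addnS.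
move=> wuv w0; rewrite exprMn [u * a * _]mulrACA -wuv -[RHS]mulf_div.
by rewrite divff ?mul1r// expf_neq0.
Qed.

End hermite_complex.

Theorem theorem15 (R : realType) :
  (forall (k : nat) (n x : R), (0 < k)%N -> 0 < x ->
     (2 * k)%:R - 1 < n < (2 * k)%:R ->
     pcfV n x / pcfV (n - 1) x < (x + Num.sqrt (4 * n - 2 + x ^+ 2)) / 2) /\
  (forall (k : nat) (n x : R), (0 < k)%N -> 0 < x ->
     (2 * k)%:R < n < (2 * k)%:R + 1 ->
     (x + Num.sqrt (4 * n - 6 + x ^+ 2)) / 2 < pcfV n x / pcfV (n - 1) x) /\
  (forall (k : nat) (x : R), 0 < x ->
     - 'i * ((hermite R[i] (2 * k).+1).['i * x%:C] / (hermite R[i] (2 * k)).['i * x%:C])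
       < (x + Num.sqrt (4 * k%:R + 2 + x ^+ 2))%:C) /\
  (forall (k : nat) (x : R), (0 < k)%N -> 0 < x ->
     'i * ((hermite R[i] (2 * k).-1).['i * x%:C] / (hermite R[i] (2 * k)).['i * x%:C])
       < ((x + Num.sqrt (4 * k%:R - 2 + x ^+ 2))^-1)%:C) /\
  (forall (k : nat) (x : R), (0 < k)%N -> x != 0 ->
     (hermite R[i] (2 * k)).['i * x%:C] ^+ 2
       / ((hermite R[i] (2 * k).-1).['i * x%:C] * (hermite R[i] (2 * k).+1).['i * x%:C])
       > (Num.sqrt ((k%:R - 2^-1) / (k%:R + 2^-1)))%:C).
Proof.
split; first exact: pcfV_ratio_upper.
split; first exact: pcfV_ratio_lower.
split; first exact: hermite_ratio_upper.
(* Writing the positive index as [k.+1] turns [2 * k] and its predecessor into the successor forms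
   of the lemmas. *)
split=> [[|k] x // _ x0|[|k] x // _ x0].
  rewrite mulnS (_ : 4 * k.+1%:R - 2 = 4 * k%:R + 2); first exact: hermite_ratio_lower.
  by rewrite -[k.+1%:R]natr1; ring.
by rewrite mulnS; exact: hermite_turan_ratio.
Qed.
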